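(* Let $\mathcal{C}$ be a category with families (CwF) equipped with a weakly stable weak identity type structure $(\mathsf{Id},\mathsf{refl},\mathsf{J},\mathsf{J}\beta)$. Suppose that $\mathcal{C}$ has familially representable polynomial sorts, i.e. for every closed polynomial sort $P$ of $\mathcal{C}$ the presheaf $\mathsf{Elem}(P)$ on $\mathcal{C}$ is familially representable. Then $\mathcal{C}$ can be equipped with a (strictly) stable weak identity type structure $(\mathsf{Id}^{s},\mathsf{refl}^{s},\mathsf{J}^{s},\mathsf{J}\beta^{s})$ which is equivalent to the weakly stable one: for every object $\Gamma$, type $A\in\mathsf{Ty}(\Gamma)$ and term $x\in\mathsf{Tm}(\Gamma,A)$, the types $\mathsf{Id}^{s}(A[\mathbf{p}_A],x[\mathbf{p}_A],\mathbf{q}_A)$ and $\mathsf{Id}_{(\Gamma,A,x)}$ in $\mathsf{Ty}(\Gamma.A)$ are equivalent.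
   Context: A CwF consists of a category $\mathcal{C}$ with terminal object $\diamond$, a presheaf $\mathsf{Ty}$ of types on $\mathcal{C}$, and for each object $\Gamma$ and $A\in\mathsf{Ty}(\Gamma)$ a set $\mathsf{Tm}(\Gamma,A)$ of terms, with substitution actions $A[\rho]$, $a[\rho]$ along $\rho:\Delta\to\Gamma$ that are functorial; and for each $A\in\mathsf{Ty}(\Gamma)$ a context extension $\Gamma.A$ with $\mathbf{p}_A:\Gamma.A\to\Gamma$ and $\mathbf{q}_A\in\mathsf{Tm}(\Gamma.A,A[\mathbf{p}_A])$ such that morphisms $\Delta\to\Gamma.A$ correspond bijectively (via $\mathbf{p}_A\circ-$, $\mathbf{q}_A[-]$) to pairs $\langle\rho,a\rangle$ with $\rho:\Delta\to\Gamma$, $a\in\mathsf{Tm}(\Delta,A[\rho])$. For $\rho:\Delta\to\Gamma$, write $\rho^+=\langle\rho\circ\mathbf{p},\mathbf{q}\rangle:\Delta.A[\rho]\to\Gamma.A$. A telescope over $\Gamma$ is a finite sequence of types $A_1\in\mathsf{Ty}(\Gamma)$, $A_2\in\mathsf{Ty}(\Gamma.A_1)$, \dots; $\Gamma.\Delta$ denotes iterated extension and $\mathbf{p}_\Delta:\Gamma.\Delta\to\Gamma$ the composite projection. Weakly stable weak identity types: for every triple $(\Gamma,A,x)$ with $A\in\mathsf{Ty}(\Gamma)$, $x\in\mathsf{Tm}(\Gamma,A)$ (an Id-introduction context), a type $\mathsf{Id}_{(\Gamma,A,x)}\in\mathsf{Ty}(\Gamma.A)$ and a term $\mathsf{refl}_{(\Gamma,A,x)}\in\mathsf{Tm}(\Gamma,\mathsf{Id}_{(\Gamma,A,x)}[\langle\mathrm{id},x\rangle])$,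 with no naturality in $\Gamma$ required. For every Id-elimination context $(\Delta,\gamma,P,d)$ over $(\Gamma,A,x)$, meaning $\gamma:\Delta\to\Gamma$, $P\in\mathsf{Ty}(\Delta.A[\gamma].\mathsf{Id}_{(\Gamma,A,x)}[\gamma^+])$ and $d\in\mathsf{Tm}(\Delta,P')$ with $P'=P[\langle\mathrm{id},x[\gamma],\mathsf{refl}_{(\Gamma,A,x)}[\gamma]\rangle]$, a term $\mathsf{J}_{(\Gamma,A,x,\Delta,\gamma,P,d)}\in\mathsf{Tm}(\Delta.A[\gamma].\mathsf{Id}_{(\Gamma,A,x)}[\gamma^+],P)$ and a term $\mathsf{J}\beta\in\mathsf{Tm}(\Delta,\mathsf{Id}_{(\Delta,P',d)}[\langle\mathrm{id},j\rangle])$ where $j=\mathsf{J}_{(\Gamma,A,x,\Delta,\gamma,P,d)}[\langle\mathrm{id},x[\gamma],\mathsf{refl}_{(\Gamma,A,x)}[\gamma]\rangle]$; again no naturality required. A (strictly) stable weak identity type structure consists of $\mathsf{Id}(A,x,y)\in\mathsf{Ty}(\Gamma)$ for $A\in\mathsf{Ty}(\Gamma)$, $x,y\in\mathsf{Tm}(\Gamma,A)$, $\mathsf{refl}(A,x)\in\mathsf{Tm}(\Gamma,\mathsf{Id}(A,x,x))$, and for $P\in\mathsf{Ty}(\Gamma.A.\mathsf{Id}(A[\mathbf{p}],x[\mathbf{p}],\mathbf{q}))$, $d\in\mathsf{Tm}(\Gamma,P[\langle\mathrm{id},x,\mathsf{refl}(A,x)\rangle])$, terms $\mathsf{J}(A,x,P,d)\in\mathsf{Tm}(\Gamma.A.\mathsf{Id}(A[\mathbf{p}],x[\mathbf{p}],\mathbf{q}),P)$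 and $\mathsf{J}\beta(A,x,P,d)\in\mathsf{Tm}(\Gamma,\mathsf{Id}(P[\langle\mathrm{id},x,\mathsf{refl}\rangle],\mathsf{J}(A,x,P,d)[\langle\mathrm{id},x,\mathsf{refl}\rangle],d))$, all of these commuting strictly with substitution along every $\rho:\Delta\to\Gamma$. Types $B,B'\in\mathsf{Ty}(\Theta)$ are equivalent if there are maps $f\in\mathsf{Tm}(\Theta.B,B'[\mathbf{p}])$, $g\in\mathsf{Tm}(\Theta.B',B[\mathbf{p}])$ that are mutually inverse up to typal equality (terms of the identity types), i.e. an equivalence in the usual homotopy-type-theoretic sense expressed with the given identity types. Familial representability: a presheaf $X$ on $\mathcal{C}$ is familially representable if every connected component of its category of elements $\int_{\mathcal{C}}X$ has a terminal object; equivalently $X$ is a coproduct of representable presheaves. Polynomial sorts: a monomial sort over $\Gamma$ is either $[\Delta\vdash\mathbb{ty}]$ or $[\Delta\vdash\mathbb{tm}(A)]$, where $\Delta$ is a telescope over $\Gamma$ and $A\in\mathsf{Ty}(\Gamma.\Delta)$; these form a presheaf $\mathsf{MonoSort}$ under substitution, and their elements over $\Gamma$ are $\mathsf{Elem}([\Delta\vdash\mathbb{ty}])=\mathsf{Ty}(\Gamma.\Delta)$, $\mathsf{Elem}([\Delta\vdash\mathbb{tm}(A)])=\mathsf{Tm}(\Gamma.\Delta,A)$. Closed polynomial sorts $P$ and their element presheaves $\mathsf{Elem}(P)$ are defined inductively: the empty sort $\diamond$ with $\mathsf{Elem}(\diamond)$ the terminal presheaf; and $P.M$ where $M$ assigns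 naturally to every $\Gamma$ and $e\in\mathsf{Elem}(P)(\Gamma)$ a monomial sort $M(e)$ over $\Gamma$, with $\mathsf{Elem}(P.M)(\Gamma)=\{(e,m): e\in\mathsf{Elem}(P)(\Gamma), m\in\mathsf{Elem}(M(e))\}$. *)

(* Defs.v *)
(* Plain Rocq with Stdlib.  Equality of objects, morphisms, types and terms is
   Leibniz equality; types are treated as sets (proof irrelevance gives UIP). *)
From Stdlib Require Import Relations ProofIrrelevance.

Set Implicit Arguments.
Unset Strict Implicit.
Unset Printing Implicit Defensive.

(** * Transport and equality over an equality of indices *)

Definition cast {I : Type} (F : I -> Type) {i j : I} (e : i = j) (a : F i) : F j :=
  eq_rect i F a j e.

Arguments cast {I} F {i j} e a.

Definition eq_over {I : Type} (F : I -> Type) {i j : I} (a : F i) (b : F j) : Prop :=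
  exists e : i = j, cast F e a = b.

Arguments eq_over {I} F {i j} a b.

Lemma eq_over_refl {I} (F : I -> Type) {i} (a : F i) : eq_over F a a.
Proof. exists eq_refl; reflexivity. Qed.

Lemma eq_over_sym {I} (F : I -> Type) {i j} (a : F i) (b : F j) :
  eq_over F a b -> eq_over F b a.
Proof. intros [e H]; destruct e; destruct H; apply eq_over_refl. Qed.

Lemma eq_over_trans {I} (F : I -> Type) {i j k} (a : F i) (b : F j) (c : F k) :
  eq_over F a b -> eq_over F b c -> eq_over F a c.
Proof. intros [e H] H'; destruct e; destruct H; exact H'. Qed.

Lemma eq_over_castl {I} (F : I -> Type) {i j} (e : i = j) (a : F i) :
  eq_over F (cast F e a) a.
Proof. destruct e; apply eq_over_refl. Qed.

Lemma eq_over_castr {I} (F : I -> Type) {i j} (e : i = j) (a : F i) :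
  eq_over F a (cast F e a).
Proof. destruct e; apply eq_over_refl. Qed.

Lemma eq_over_eq {I} (F : I -> Type) {i} (a b : F i) : eq_over F a b -> a = b.
Proof. intros [e H]; rewrite (proof_irrelevance _ e eq_refl) in H; exact H. Qed.

Lemma eq_over_existT {I} (F : I -> Type) {i j} (a : F i) (b : F j) :
  eq_over F a b -> existT F i a = existT F j b.
Proof. intros [e H]; destruct e; destruct H; reflexivity. Qed.

Lemma existT_eq_over {I} (F : I -> Type) {i j} (a : F i) (b : F j) :
  existT F i a = existT F j b -> eq_over F a b.
Proof.
intros H; change (eq_over F (projT2 (existT F i a)) (projT2 (existT F j b))).
rewrite H; apply eq_over_refl.
Qed.

(** * Categories, presheaves, familial representability *)

Record Category := {
  Ob :> Type;
  Hom : Ob -> Ob -> Type;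
  idm : forall G, Hom G G;
  comp : forall G D E, Hom D G -> Hom E D -> Hom E G;
  comp_idl : forall G D (r : Hom D G), comp (idm G) r = r;
  comp_idr : forall G D (r : Hom D G), comp r (idm D) = r;
  comp_assoc : forall G D E F (r : Hom D G) (s : Hom E D) (t : Hom F E),
    comp (comp r s) t = comp r (comp s t) }.

Arguments Hom {c} _ _.
Arguments idm {c} G.
Arguments comp {c G D E} _ _.

Notation "r \o s" := (comp r s) (at level 50, left associativity).

Record Presheaf (C : Category) := {
  psh :> Ob C -> Type;
  restr : forall G D, Hom D G -> psh G -> psh D;
  restr_id : forall G (x : psh G), restr (idm G) x = x;
  restr_comp : forall G D E (r : Hom D G) (s : Hom E D) (x : psh G),
    restr (r \o s) x = restr s (restr r x) }.

Arguments restr {C p G D} _ _.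
Arguments restr_id {C p G} _.
Arguments restr_comp {C p G D E} _ _ _.

Notation "x .[ r ]" := (restr r x) (at level 2, left associativity, format "x .[ r ]").

Record NatTrans {C : Category} (X Y : Presheaf C) := {
  app :> forall G, X G -> Y G;
  app_nat : forall G D (r : Hom D G) (x : X G), app x.[r] = (app x).[r] }.

Definition is_terminal_in {C : Category} (S : C -> Prop) (t : C) : Prop :=
  S t /\ forall b, S b -> exists f : Hom b t, forall g : Hom b t, g = f.

Definition connected {C : Category} : C -> C -> Prop :=
  clos_refl_sym_trans C (fun a b => inhabited (Hom a b)).

Definition EltOb {C : Category} (X : Presheaf C) : Type := {G : C & X G}.

Definition EltHom {C : Category} {X : Presheaf C} (a b : EltOb X) : Type :=
  {r : Hom (projT1 a) (projT1 b) | (projT2 b).[r] = projT2 a}.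

Lemma EltHom_eq {C : Category} {X : Presheaf C} {a b : EltOb X} (f g : EltHom a b) :
  proj1_sig f = proj1_sig g -> f = g.
Proof.
destruct f as [r Hr], g as [s Hs]; simpl; intros E; subst s.
rewrite (proof_irrelevance _ Hr Hs); reflexivity.
Qed.

Definition elt_id {C : Category} {X : Presheaf C} (a : EltOb X) : EltHom a a :=
  exist _ (idm _) (restr_id _).

Lemma elt_comp_proof {C : Category} {X : Presheaf C} {a b c : EltOb X}
    (f : EltHom b a) (g : EltHom c b) :
  (projT2 a).[proj1_sig f \o proj1_sig g] = projT2 c.
Proof.
destruct f as [r Hr], g as [s Hs]; simpl.
rewrite restr_comp, Hr; exact Hs.
Qed.

Definition elt_comp {C : Category} {X : Presheaf C} {a b c : EltOb X}
    (f : EltHom b a) (g : EltHom c b) : EltHom c a :=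
  exist _ (proj1_sig f \o proj1_sig g) (elt_comp_proof f g).

Definition Elements {C : Category} (X : Presheaf C) : Category.
Proof.
refine (@Build_Category (EltOb X) (@EltHom C X) elt_id (@elt_comp C X) _ _ _);
  intros; apply EltHom_eq; simpl.
- apply comp_idl.
- apply comp_idr.
- apply comp_assoc.
Defined.

Definition familially_representable {C : Category} (X : Presheaf C) : Prop :=
  forall a : Elements X, exists t : Elements X, is_terminal_in (connected a) t.

(** * Categories with families *)

Record CwF := {
  cat :> Category;
  emp : cat;
  bang : forall G : cat, Hom G emp;
  bang_uniq : forall (G : cat) (r : Hom G emp), r = bang G;
  Ty : Presheaf cat;
  Tm : forall G : cat, Ty G -> Type;
  tmsub : forall (G D : cat) (r : Hom D G) (A : Ty G), Tm A -> Tm A.[r];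
  tmsub_id : forall (G : cat) (A : Ty G) (a : Tm A),
    eq_over (@Tm G) (tmsub (idm G) a) a;
  tmsub_comp : forall (G D E : cat) (r : Hom D G) (s : Hom E D) (A : Ty G) (a : Tm A),
    eq_over (@Tm E) (tmsub (r \o s) a) (tmsub s (tmsub r a));
  ext : forall G : cat, Ty G -> cat;
  pp : forall (G : cat) (A : Ty G), Hom (ext A) G;
  qq : forall (G : cat) (A : Ty G), Tm A.[pp A];
  pair : forall (G D : cat) (A : Ty G) (r : Hom D G), Tm A.[r] -> Hom D (ext A);
  pp_pair : forall (G D : cat) (A : Ty G) (r : Hom D G) (a : Tm A.[r]),
    pp A \o pair a = r;
  qq_pair : forall (G D : cat) (A : Ty G) (r : Hom D G) (a : Tm A.[r]),
    eq_over (@Tm D) (tmsub (pair a) (qq A)) a;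
  pair_uniq : forall (G D : cat) (A : Ty G) (r : Hom D G) (a : Tm A.[r])
      (s : Hom D (ext A)),
    pp A \o s = r -> eq_over (@Tm D) (tmsub s (qq A)) a -> s = pair a }.

Arguments Ty {c}.
Arguments Tm {c} G A.
Arguments tmsub {c G D} r {A} a.
Arguments tmsub_id {c G A} a.
Arguments tmsub_comp {c G D E} r s {A} a.
Arguments ext {c} G A.
Arguments pp {c G} A.
Arguments qq {c G} A.
Arguments pair {c G D} A r a.
Arguments pp_pair {c G D A r} a.
Arguments qq_pair {c G D A r} a.
Arguments pair_uniq {c G D A r a s} _ _.

Notation "a .{ r }" := (tmsub r a) (at level 2, left associativity, format "a .{ r }").
Notation "G ,, A" := (ext G A) (at level 50, left associativity).
Notation "a =~ b" := (eq_over (Tm _) a b) (at level 70).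

Lemma tmsub_eq_over {C : CwF} {G D : C} (r : Hom D G) {A B : Ty G}
    (a : Tm G A) (b : Tm G B) : a =~ b -> a.{r} =~ b.{r}.
Proof. intros [e H]; destruct e; destruct H; apply eq_over_refl. Qed.

Lemma tmsub_eq_hom {C : CwF} {G D : C} (r s : Hom D G) {A : Ty G} (a : Tm G A) :
  r = s -> a.{r} =~ a.{s}.
Proof. intros e; destruct e; apply eq_over_refl. Qed.

Lemma pair_eq {C : CwF} {G D : C} {A : Ty G} {r r' : Hom D G}
    (a : Tm D A.[r]) (a' : Tm D A.[r']) :
  r = r' -> a =~ a' -> pair A r a = pair A r' a'.
Proof. intros e H; destruct e; apply eq_over_eq in H; destruct H; reflexivity. Qed.

Lemma hom_ext {C : CwF} {G D : C} {A : Ty G} (s t : Hom D (G ,, A)) :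
  pp A \o s = pp A \o t -> (qq A).{s} =~ (qq A).{t} -> s = t.
Proof.
intros H1 H2.
rewrite (@pair_uniq C G D A (pp A \o t)
  (cast (Tm D) (eq_sym (restr_comp _ _ _)) (qq A).{t}) s H1).
- symmetry; apply pair_uniq; [reflexivity | apply eq_over_castr].
- eapply eq_over_trans; [exact H2 | apply eq_over_castr].
Qed.

(** For [B = A[r]], the morphism <r o p, q> from [D.B] to [G.A]; [B] is left free
    so that [D.B] need not be literally [D.A[r]]. *)

Lemma lift_along_proof {C : CwF} {G D : C} (r : Hom D G) (A : Ty G) (B : Ty D) :
  B = A.[r] -> B.[pp B] = A.[r \o pp B].
Proof. intros e; rewrite restr_comp, <- e; reflexivity. Qed.

Definition lift_along {C : CwF} {G D : C} (r : Hom D G) (A : Ty G) (B : Ty D)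
    (e : B = A.[r]) : Hom (D ,, B) (G ,, A) :=
  pair A (r \o pp B) (cast (Tm _) (lift_along_proof e) (qq B)).

Definition lift {C : CwF} {G D : C} (r : Hom D G) (A : Ty G) :
    Hom (D ,, A.[r]) (G ,, A) :=
  lift_along (eq_refl A.[r]).

Definition sect {C : CwF} {G : C} {A : Ty G} (a : Tm G A) : Hom G (G ,, A) :=
  pair A (idm G) (cast (Tm G) (eq_sym (restr_id A)) a).

Lemma pp_lift_along {C : CwF} {G D : C} (r : Hom D G) (A : Ty G) (B : Ty D)
    (e : B = A.[r]) : pp A \o lift_along e = r \o pp B.
Proof. apply pp_pair. Qed.

Lemma qq_lift_along {C : CwF} {G D : C} (r : Hom D G) (A : Ty G) (B : Ty D)
    (e : B = A.[r]) : (qq A).{lift_along e} =~ qq B.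
Proof. eapply eq_over_trans; [apply qq_pair | apply eq_over_castl]. Qed.

Lemma pp_sect {C : CwF} {G : C} {A : Ty G} (a : Tm G A) : pp A \o sect a = idm G.
Proof. apply pp_pair. Qed.

Lemma qq_sect {C : CwF} {G : C} {A : Ty G} (a : Tm G A) : (qq A).{sect a} =~ a.
Proof. eapply eq_over_trans; [apply qq_pair | apply eq_over_castl]. Qed.

Lemma lift_along_pair {C : CwF} {G D E : C} (r : Hom D G) (A : Ty G) (B : Ty D)
    (e : B = A.[r]) (s : Hom E (D ,, B)) (t : Hom E (G ,, A)) :
  r \o (pp B \o s) = pp A \o t -> (qq B).{s} =~ (qq A).{t} ->
  lift_along e \o s = t.
Proof.
intros H1 H2; apply hom_ext.
- rewrite <- comp_assoc, pp_lift_along, comp_assoc; exact H1.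
- eapply eq_over_trans; [apply tmsub_comp |].
  eapply eq_over_trans; [apply tmsub_eq_over, qq_lift_along | exact H2].
Qed.

Lemma sect_nat {C : CwF} {G D : C} (r : Hom D G) {A : Ty G} (a : Tm G A) :
  sect a \o r = lift r A \o sect a.{r}.
Proof.
symmetry; apply lift_along_pair.
- rewrite pp_sect, comp_idr, <- comp_assoc, pp_sect, comp_idl; reflexivity.
- eapply eq_over_trans; [apply qq_sect |].
  apply eq_over_sym; eapply eq_over_trans; [apply tmsub_comp |].
  apply tmsub_eq_over, qq_sect.
Qed.

(** * Telescopes and polynomial sorts *)

Inductive Tel {C : CwF} (G : C) : Type :=
| tnil : Tel G
| tcons (A : Ty G) (T : Tel (G ,, A)) : Tel G.

Arguments tnil {C G}.
Arguments tcons {C G} A T.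

Fixpoint tel_ext {C : CwF} {G : C} (T : Tel G) : C :=
  match T with
  | tnil => G
  | tcons _ T' => tel_ext T'
  end.

Fixpoint tel_sub {C : CwF} {G D : C} (r : Hom D G) (T : Tel G) : Tel D :=
  match T with
  | tnil => tnil
  | tcons A T' => tcons A.[r] (tel_sub (lift r A) T')
  end.

Fixpoint tel_lift {C : CwF} {G D : C} (r : Hom D G) (T : Tel G) :
    Hom (tel_ext (tel_sub r T)) (tel_ext T) :=
  match T with
  | tnil => r
  | tcons A T' => tel_lift (lift r A) T'
  end.

Lemma lift_id {C : CwF} {G : C} (A : Ty G) :
  existT (fun B : Ty G => Hom (G ,, B) (G ,, A)) A.[idm G] (lift (idm G) A)
  = existT _ A (idm (G ,, A)).
Proof.
unfold lift.
enough (H : forall B (e : B = A.[idm G]),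
  existT (fun B : Ty G => Hom (G ,, B) (G ,, A)) B (lift_along e)
  = existT _ A (idm (G ,, A))) by apply H.
intros B e; assert (E : B = A) by (rewrite e; apply restr_id).
revert e; rewrite E; intros e; f_equal.
rewrite <- (comp_idr (lift_along e)); apply lift_along_pair.
- rewrite comp_idl; reflexivity.
- apply eq_over_refl.
Qed.

Lemma lift_comp {C : CwF} {G D E : C} (r : Hom D G) (s : Hom E D) (A : Ty G) :
  existT (fun B : Ty E => Hom (E ,, B) (G ,, A)) A.[r \o s] (lift (r \o s) A)
  = existT _ A.[r].[s] (lift r A \o lift s A.[r]).
Proof.
unfold lift at 1.
enough (H : forall B (e : B = A.[r \o s]),
  existT (fun B : Ty E => Hom (E ,, B) (G ,, A)) B (lift_along e)
  = existT _ A.[r].[s] (lift r A \o lift s A.[r])) by apply H.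
intros B e; assert (E' : B = A.[r].[s]) by (rewrite e; apply restr_comp).
revert e; rewrite E'; intros e; f_equal.
rewrite <- (comp_idr (lift_along e)); apply lift_along_pair.
- unfold lift; rewrite comp_idr, <- (comp_assoc (pp A)), pp_lift_along.
  rewrite !comp_assoc, pp_lift_along; reflexivity.
- eapply eq_over_trans; [apply tmsub_id |].
  apply eq_over_sym; eapply eq_over_trans; [apply tmsub_comp |].
  eapply eq_over_trans; [apply tmsub_eq_over, qq_lift_along | apply qq_lift_along].
Qed.

Lemma tel_lift_id {C : CwF} {G : C} (T : Tel G) :
  existT (fun T' : Tel G => Hom (tel_ext T') (tel_ext T)) (tel_sub (idm G) T)
    (tel_lift (idm G) T)
  = existT _ T (idm (tel_ext T)).
Proof.
induction T as [G | G A T IH]; [reflexivity |].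
pose (F := fun u : {B : Ty G & Hom (G ,, B) (G ,, A)} =>
  existT (fun T' : Tel G => Hom (tel_ext T') (tel_ext T))
    (tcons (projT1 u) (tel_sub (projT2 u) T)) (tel_lift (projT2 u) T)).
transitivity (F (existT _ A (idm (G ,, A)))).
- exact (f_equal F (lift_id A)).
- exact (f_equal (fun u : {T' : Tel (G ,, A) & Hom (tel_ext T') (tel_ext T)} =>
    existT (fun T' : Tel G => Hom (tel_ext T') (tel_ext T))
      (tcons A (projT1 u)) (projT2 u)) IH).
Qed.

Lemma tel_lift_comp {C : CwF} {G D E : C} (r : Hom D G) (s : Hom E D) (T : Tel G) :
  existT (fun T' : Tel E => Hom (tel_ext T') (tel_ext T)) (tel_sub (r \o s) T)
    (tel_lift (r \o s) T)
  = existT _ (tel_sub s (tel_sub r T)) (tel_lift r T \o tel_lift s (tel_sub r T)).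
Proof.
revert D E r s; induction T as [G | G A T IH]; intros D E r s; [reflexivity |].
pose (F := fun u : {B : Ty E & Hom (E ,, B) (G ,, A)} =>
  existT (fun T' : Tel E => Hom (tel_ext T') (tel_ext T))
    (tcons (projT1 u) (tel_sub (projT2 u) T)) (tel_lift (projT2 u) T)).
transitivity (F (existT _ A.[r].[s] (lift r A \o lift s A.[r]))).
- exact (f_equal F (lift_comp r s A)).
- exact (f_equal (fun u : {T' : Tel (E ,, A.[r].[s]) & Hom (tel_ext T') (tel_ext T)} =>
    existT (fun T' : Tel E => Hom (tel_ext T') (tel_ext T))
      (tcons A.[r].[s] (projT1 u)) (projT2 u)) (IH _ _ (lift r A) (lift s A.[r]))).
Qed.

Inductive Mono {C : CwF} (G : C) : Type :=
| mono_ty (T : Tel G)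
| mono_tm (T : Tel G) (A : Ty (tel_ext T)).

Arguments mono_ty {C G} T.
Arguments mono_tm {C G} T A.

Definition mono_sub {C : CwF} {G D : C} (r : Hom D G) (M : Mono G) : Mono D :=
  match M with
  | mono_ty T => mono_ty (tel_sub r T)
  | mono_tm T A => mono_tm (tel_sub r T) A.[tel_lift r T]
  end.

Definition MonoElem {C : CwF} {G : C} (M : Mono G) : Type :=
  match M with
  | mono_ty T => Ty (tel_ext T)
  | mono_tm T A => Tm (tel_ext T) A
  end.

Definition mono_elem_sub {C : CwF} {G D : C} (r : Hom D G) {M : Mono G} :
    MonoElem M -> MonoElem (mono_sub r M) :=
  match M return MonoElem M -> MonoElem (mono_sub r M) with
  | mono_ty T => fun A => A.[tel_lift r T]
  | mono_tm T A => fun a => a.{tel_lift r T}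
  end.

Lemma mono_elem_sub_eq_over {C : CwF} {G D : C} (r : Hom D G) {M N : Mono G}
    (m : MonoElem M) (n : MonoElem N) :
  eq_over MonoElem m n -> eq_over MonoElem (mono_elem_sub r m) (mono_elem_sub r n).
Proof. intros [e H]; destruct e; destruct H; apply eq_over_refl. Qed.

Lemma mono_elem_sub_id {C : CwF} {G : C} (M : Mono G) (m : MonoElem M) :
  eq_over MonoElem (mono_elem_sub (idm G) m) m.
Proof.
apply existT_eq_over; destruct M as [T | T A]; simpl in m |- *.
- transitivity (existT (@MonoElem C G) (mono_ty T) m.[idm (tel_ext T)]).
  + exact (f_equal (fun u : {T' : Tel G & Hom (tel_ext T') (tel_ext T)} =>
      existT (@MonoElem C G) (mono_ty (projT1 u)) m.[projT2 u]) (tel_lift_id T)).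
  + rewrite restr_id; reflexivity.
- transitivity (existT (@MonoElem C G) (mono_tm T A.[idm (tel_ext T)])
    m.{idm (tel_ext T)}).
  + exact (f_equal (fun u : {T' : Tel G & Hom (tel_ext T') (tel_ext T)} =>
      existT (@MonoElem C G) (mono_tm (projT1 u) A.[projT2 u]) m.{projT2 u})
      (tel_lift_id T)).
  + exact (f_equal (fun u : {B : Ty (tel_ext T) & Tm _ B} =>
      existT (@MonoElem C G) (mono_tm T (projT1 u)) (projT2 u))
      (eq_over_existT (tmsub_id m))).
Qed.

Lemma mono_elem_sub_comp {C : CwF} {G D E : C} (r : Hom D G) (s : Hom E D)
    (M : Mono G) (m : MonoElem M) :
  eq_over MonoElem (mono_elem_sub (r \o s) m) (mono_elem_sub s (mono_elem_sub r m)).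
Proof.
apply existT_eq_over; destruct M as [T | T A]; simpl in m |- *.
- transitivity (existT (@MonoElem C E) (mono_ty (tel_sub s (tel_sub r T)))
    m.[tel_lift r T \o tel_lift s (tel_sub r T)]).
  + exact (f_equal (fun u : {T' : Tel E & Hom (tel_ext T') (tel_ext T)} =>
      existT (@MonoElem C E) (mono_ty (projT1 u)) m.[projT2 u]) (tel_lift_comp r s T)).
  + rewrite restr_comp; reflexivity.
- transitivity (existT (@MonoElem C E)
    (mono_tm (tel_sub s (tel_sub r T)) A.[tel_lift r T \o tel_lift s (tel_sub r T)])
    m.{tel_lift r T \o tel_lift s (tel_sub r T)}).
  + exact (f_equal (fun u : {T' : Tel E & Hom (tel_ext T') (tel_ext T)} =>
      existT (@MonoElem C E) (mono_tm (projT1 u) A.[projT2 u]) m.{projT2 u})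
      (tel_lift_comp r s T)).
  + exact (f_equal (fun u : {B : Ty (tel_ext (tel_sub s (tel_sub r T))) & Tm _ B} =>
      existT (@MonoElem C E) (mono_tm (tel_sub s (tel_sub r T)) (projT1 u)) (projT2 u))
      (eq_over_existT
        (tmsub_comp (tel_lift r T) (tel_lift s (tel_sub r T)) m))).
Qed.

Lemma mono_sub_id {C : CwF} {G : C} (M : Mono G) : mono_sub (idm G) M = M.
Proof.
destruct M as [T | T A]; simpl.
- exact (f_equal (fun u : {T' : Tel G & Hom (tel_ext T') (tel_ext T)} =>
    mono_ty (projT1 u)) (tel_lift_id T)).
- transitivity (mono_tm T A.[idm (tel_ext T)]); [| rewrite restr_id; reflexivity].
  exact (f_equal (fun u : {T' : Tel G & Hom (tel_ext T') (tel_ext T)} =>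
    mono_tm (projT1 u) A.[projT2 u]) (tel_lift_id T)).
Qed.

Lemma mono_sub_comp {C : CwF} {G D E : C} (r : Hom D G) (s : Hom E D) (M : Mono G) :
  mono_sub (r \o s) M = mono_sub s (mono_sub r M).
Proof.
destruct M as [T | T A]; simpl.
- exact (f_equal (fun u : {T' : Tel E & Hom (tel_ext T') (tel_ext T)} =>
    mono_ty (projT1 u)) (tel_lift_comp r s T)).
- transitivity (mono_tm (tel_sub s (tel_sub r T))
    A.[tel_lift r T \o tel_lift s (tel_sub r T)]); [| rewrite restr_comp; reflexivity].
  exact (f_equal (fun u : {T' : Tel E & Hom (tel_ext T') (tel_ext T)} =>
    mono_tm (projT1 u) A.[projT2 u]) (tel_lift_comp r s T)).
Qed.

Definition MonoSort (C : CwF) : Presheaf C :=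
  @Build_Presheaf C (@Mono C) (@mono_sub C) (@mono_sub_id C) (@mono_sub_comp C).

Definition TermPsh (C : Category) : Presheaf C :=
  @Build_Presheaf C (fun _ => unit) (fun _ _ _ x => x)
    (fun _ _ => eq_refl) (fun _ _ _ _ _ _ => eq_refl).

Definition ext_psh_sub {C : CwF} {X : Presheaf C} (M : NatTrans X (MonoSort C))
    {G D : C} (r : Hom D G) (u : {e : X G & MonoElem (M G e)}) :
    {e : X D & MonoElem (M D e)} :=
  existT (fun e : X D => MonoElem (M D e)) (projT1 u).[r]
    (cast MonoElem (eq_sym (app_nat M r (projT1 u))) (mono_elem_sub r (projT2 u))).

Lemma ext_psh_eq {C : CwF} {X : Presheaf C} (M : NatTrans X (MonoSort C))
    {G : C} (e e' : X G) (m : MonoElem (M G e)) (m' : MonoElem (M G e')) :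
  e = e' -> eq_over (@MonoElem C G) m m' ->
  existT (fun e : X G => MonoElem (M G e)) e m = existT _ e' m'.
Proof. intros E H; subst e'; apply eq_over_eq in H; subst m'; reflexivity. Qed.

Definition ext_psh {C : CwF} (X : Presheaf C) (M : NatTrans X (MonoSort C)) :
    Presheaf C.
Proof.
refine (@Build_Presheaf C (fun G => {e : X G & MonoElem (M G e)})
  (@ext_psh_sub C X M) _ _).
- intros G [e m]; apply ext_psh_eq; [apply restr_id |].
  eapply eq_over_trans; [apply eq_over_castl | apply mono_elem_sub_id].
- intros G D E r s [e m]; apply ext_psh_eq; [apply restr_comp |].
  eapply eq_over_trans; [apply eq_over_castl |].
  eapply eq_over_trans; [apply mono_elem_sub_comp |].
  eapply eq_over_trans; [| apply eq_over_castr].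
  apply mono_elem_sub_eq_over, eq_over_castr.
Defined.

(** Closed polynomial sorts and their presheaves of elements form an
    inductive-recursive definition; it is encoded as an inductive family indexed by
    the presheaf of elements. *)
Inductive PolyCode {C : CwF} : Presheaf C -> Type :=
| poly_nil : PolyCode (TermPsh C)
| poly_snoc (X : Presheaf C) (P : PolyCode X) (M : NatTrans X (MonoSort C)) :
    PolyCode (ext_psh M).

Record PolySort (C : CwF) := {
  Elem : Presheaf C;
  poly_code : PolyCode Elem }.

Definition has_familially_representable_poly_sorts (C : CwF) : Prop :=
  forall P : PolySort C, familially_representable (Elem P).

(** * Weakly stable weak identity types *)

Record WeakIdIntro (C : CwF) := {
  wId : forall (G : C) (A : Ty G), Tm G A -> Ty (G ,, A);
  wrefl : forall (G : C) (A : Ty G) (x : Tm G A), Tm G (wId x).[sect x] }.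

Arguments wId {C} w {G} A x.
Arguments wrefl {C} w {G} A x.

Lemma wk_refl_inst_proof {C : CwF} (W : WeakIdIntro C) {G D : C} (A : Ty G)
    (x : Tm G A) (r : Hom D G) :
  (wId W A x).[sect x].[r] = (wId W A x).[lift r A].[sect x.{r}].
Proof. rewrite <- !restr_comp, sect_nat; reflexivity. Qed.

(** The substitution <id, x[r], refl[r]>. *)
Definition wk_refl_inst {C : CwF} (W : WeakIdIntro C) {G D : C} (A : Ty G)
    (x : Tm G A) (r : Hom D G) :
    Hom D (D ,, A.[r] ,, (wId W A x).[lift r A]) :=
  pair _ (sect x.{r}) (cast (Tm D) (wk_refl_inst_proof W x r) (wrefl W A x).{r}).

Record WeakId (C : CwF) := {
  wintro :> WeakIdIntro C;
  wJ : forall (G : C) (A : Ty G) (x : Tm G A) (D : C) (r : Hom D G)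
      (P : Ty (D ,, A.[r] ,, (wId wintro A x).[lift r A]))
      (d : Tm D P.[wk_refl_inst wintro x r]),
    Tm (D ,, A.[r] ,, (wId wintro A x).[lift r A]) P;
  wJbeta : forall (G : C) (A : Ty G) (x : Tm G A) (D : C) (r : Hom D G)
      (P : Ty (D ,, A.[r] ,, (wId wintro A x).[lift r A]))
      (d : Tm D P.[wk_refl_inst wintro x r]),
    Tm D (wId wintro P.[wk_refl_inst wintro x r] d)
           .[sect (wJ d).{wk_refl_inst wintro x r}] }.

(** The type of typal equalities between [x] and [y]. *)
Definition weq {C : CwF} (W : WeakIdIntro C) {G : C} {A : Ty G} (x y : Tm G A) : Ty G :=
  (wId W A x).[sect y].

Lemma map_comp_proof {C : CwF} {G : C} {B B' : Ty G}
    (f : Tm (G ,, B) B'.[pp B]) :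
  B.[pp B'].[pair B' (pp B) f] = B.[pp B].
Proof. rewrite <- restr_comp, pp_pair; reflexivity. Qed.

(** For maps [f : B -> B'] and [g : B' -> B] over [G], the composite [g o f],
    i.e. [g[<p, f>]]. *)
Definition map_comp {C : CwF} {G : C} {B B' : Ty G}
    (g : Tm (G ,, B') B.[pp B']) (f : Tm (G ,, B) B'.[pp B]) : Tm (G ,, B) B.[pp B] :=
  cast (Tm _) (map_comp_proof f) g.{pair B' (pp B) f}.

Definition equivalent_types {C : CwF} (W : WeakIdIntro C) {G : C} (B B' : Ty G) : Prop :=
  exists (f : Tm (G ,, B) B'.[pp B]) (g : Tm (G ,, B') B.[pp B']),
    inhabited (Tm (G ,, B) (weq W (map_comp g f) (qq B))) /\
    inhabited (Tm (G ,, B') (weq W (map_comp f g) (qq B'))).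

(** * Strictly stable weak identity types *)

Record StableIdForm (C : CwF) := {
  sId : forall (G : C) (A : Ty G), Tm G A -> Tm G A -> Ty G;
  sId_sub : forall (G D : C) (r : Hom D G) (A : Ty G) (x y : Tm G A),
    (sId x y).[r] = sId x.{r} y.{r} }.

Arguments sId {C} s {G} A x y.

Record StableIdIntro (C : CwF) := {
  sform :> StableIdForm C;
  srefl : forall (G : C) (A : Ty G) (x : Tm G A), Tm G (sId sform A x x);
  srefl_sub : forall (G D : C) (r : Hom D G) (A : Ty G) (x : Tm G A),
    (srefl x).{r} =~ srefl x.{r} }.

Arguments srefl {C} s {G} A x.

Definition pId {C : CwF} (S : StableIdForm C) {G : C} (A : Ty G) (x : Tm G A) :
    Ty (G ,, A) :=
  sId S A.[pp A] x.{pp A} (qq A).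

Arguments pId {C} S {G} A x.

Lemma sId_eq {C : CwF} (S : StableIdForm C) {G : C} {A A' : Ty G}
    (x y : Tm G A) (x' y' : Tm G A') :
  x =~ x' -> y =~ y' -> sId S A x y = sId S A' x' y'.
Proof.
intros [e Hx] Hy; destruct e; destruct Hx; apply eq_over_eq in Hy; destruct Hy.
reflexivity.
Qed.

Lemma pId_sub {C : CwF} (S : StableIdForm C) {G D : C} (r : Hom D G) (A : Ty G)
    (x : Tm G A) : pId S A.[r] x.{r} = (pId S A x).[lift r A].
Proof.
unfold pId; rewrite sId_sub; apply sId_eq.
- eapply eq_over_trans; [apply eq_over_sym, tmsub_comp |].
  eapply eq_over_trans; [| apply tmsub_comp].
  apply tmsub_eq_hom; symmetry; apply pp_lift_along.
- apply eq_over_sym, qq_lift_along.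
Qed.

Lemma pId_sect {C : CwF} (S : StableIdForm C) {G : C} (A : Ty G) (x y : Tm G A) :
  sId S A x y = (pId S A x).[sect y].
Proof.
unfold pId; rewrite sId_sub; apply sId_eq.
- apply eq_over_sym; eapply eq_over_trans; [apply eq_over_sym, tmsub_comp |].
  rewrite pp_sect; apply tmsub_id.
- apply eq_over_sym, qq_sect.
Qed.

(** The substitution <id, x, refl(A,x)>. *)
Definition st_refl_inst {C : CwF} (S : StableIdIntro C) {G : C} (A : Ty G)
    (x : Tm G A) : Hom G (G ,, A ,, pId S A x) :=
  pair _ (sect x) (cast (Tm G) (pId_sect S x x) (srefl S A x)).

(** [r^{++}], for [r : D -> G]. *)
Definition st_lift {C : CwF} (S : StableIdIntro C) {G D : C} (r : Hom D G)
    (A : Ty G) (x : Tm G A) :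
    Hom (D ,, A.[r] ,, pId S A.[r] x.{r}) (G ,, A ,, pId S A x) :=
  lift_along (pId_sub S r x).

Lemma st_refl_inst_nat {C : CwF} (S : StableIdIntro C) {G D : C} (r : Hom D G)
    (A : Ty G) (x : Tm G A) :
  st_refl_inst S x \o r = st_lift S r x \o st_refl_inst S x.{r}.
Proof.
symmetry; apply lift_along_pair; unfold st_refl_inst.
- rewrite pp_pair, <- comp_assoc, pp_pair, sect_nat; reflexivity.
- eapply eq_over_trans; [apply qq_pair |].
  eapply eq_over_trans; [apply eq_over_castl |].
  eapply eq_over_trans; [apply eq_over_sym, srefl_sub |].
  apply eq_over_sym; eapply eq_over_trans; [apply tmsub_comp |].
  apply tmsub_eq_over.
  eapply eq_over_trans; [apply qq_pair | apply eq_over_castl].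
Qed.

Lemma st_motive_sub {C : CwF} (S : StableIdIntro C) {G D : C} (r : Hom D G)
    {A : Ty G} (x : Tm G A) (P : Ty (G ,, A ,, pId S A x)) :
  P.[st_refl_inst S x].[r] = P.[st_lift S r x].[st_refl_inst S x.{r}].
Proof. rewrite <- !restr_comp, st_refl_inst_nat; reflexivity. Qed.

(** [d[r]], seen as a term of [P[r^{++}][<id, x[r], refl>]]. *)
Definition st_method_sub {C : CwF} (S : StableIdIntro C) {G D : C} (r : Hom D G)
    {A : Ty G} (x : Tm G A) (P : Ty (G ,, A ,, pId S A x))
    (d : Tm G P.[st_refl_inst S x]) :
    Tm D P.[st_lift S r x].[st_refl_inst S x.{r}] :=
  cast (Tm D) (st_motive_sub r P) d.{r}.

Record StableId (C : CwF) := {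
  sintro :> StableIdIntro C;
  sJ : forall (G : C) (A : Ty G) (x : Tm G A) (P : Ty (G ,, A ,, pId sintro A x))
      (d : Tm G P.[st_refl_inst sintro x]),
    Tm (G ,, A ,, pId sintro A x) P;
  sJ_sub : forall (G D : C) (r : Hom D G) (A : Ty G) (x : Tm G A)
      (P : Ty (G ,, A ,, pId sintro A x)) (d : Tm G P.[st_refl_inst sintro x]),
    (sJ d).{st_lift sintro r x} = sJ (st_method_sub r d);
  sJbeta : forall (G : C) (A : Ty G) (x : Tm G A) (P : Ty (G ,, A ,, pId sintro A x))
      (d : Tm G P.[st_refl_inst sintro x]),
    Tm G (sId sintro P.[st_refl_inst sintro x] (sJ d).{st_refl_inst sintro x} d);
  sJbeta_sub : forall (G D : C) (r : Hom D G) (A : Ty G) (x : Tm G A)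
      (P : Ty (G ,, A ,, pId sintro A x)) (d : Tm G P.[st_refl_inst sintro x]),
    (sJbeta d).{r} =~ sJbeta (st_method_sub r d) }.

(* Main.v *)
(** Call an element of [Elem P] generic if it is the chosen terminal object of its connected
    component: every element is the restriction of a unique generic one along a unique
    morphism, and restricting an element only precomposes that morphism. Hence any data
    chosen on generic elements and restricted along these morphisms is strictly natural.
    This is applied first to the sort of pairs (A, x), to choose an identity type with a
    reflexivity term whose pullbacks all admit weak elimination, and then to the sort of
    quadruples (A, x, P, d), to choose J and its computation term. The latter exists because
    the weakly stable identity types map into the strictly stable ones. Two identity types
    of the same (A, x) which both eliminate are equivalent. *)
From Stdlib Require Import Relations ProofIrrelevance ClassicalEpsilon
  FunctionalExtensionality PropExtensionality.
Require Import Defs.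

(** * Generic elements *)

Definition chosen {T : Type} {S : T -> Prop} (h : exists t, S t) : T :=
  proj1_sig (constructive_indefinite_description S h).

Lemma chosen_spec {T : Type} {S : T -> Prop} (h : exists t, S t) : S (chosen h).
Proof. exact (proj2_sig (constructive_indefinite_description S h)). Qed.

(** Extensionality makes equivalent predicates equal, and choice is a function of the predicate.
    Thus a generic element can depend on a connected component alone, not on the element used to
    name it. *)
Lemma chosen_ext {T : Type} {S S' : T -> Prop} (h : exists t, S t) (h' : exists t, S' t) :
  (forall t, S t <-> S' t) -> chosen h = chosen h'.
Proof.
intros H; assert (E : S = S').
{ apply functional_extensionality; intros t; apply propositional_extensionality, H. }
destruct E; rewrite (proof_irrelevance _ h h'); reflexivity.
Qed.

(** A coherent choice, for every element [x] of [X], of a generic element of which [x] is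
    an instance in a natural way. *)
Definition has_generics {C : Category} (X : Presheaf C) : Prop :=
  exists (t : forall G, X G -> EltOb X) (u : forall G (x : X G), Hom G (projT1 (t G x))),
    (forall G (x : X G), (projT2 (t G x)).[u G x] = x) /\
    (forall G D (r : Hom D G) (x : X G),
      existT (fun a : EltOb X => Hom D (projT1 a)) (t D x.[r]) (u D x.[r])
      = existT _ (t G x) (u G x \o r)).

Lemma familially_representable_has_generics {C : Category} (X : Presheaf C) :
  familially_representable X -> has_generics X.
Proof.
intros hX.
pose (t := fun a : Elements X => chosen (hX a)).
assert (ht : forall a, is_terminal_in (connected a) (t a)) by (intros a; apply chosen_spec).
assert (hu : forall a, exists f : Hom a (t a), forall g : Hom a (t a), g = f).
{ intros a; apply (ht a), rst_refl. }
pose (u := fun a => chosen (hu a)).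
assert (hconn : forall a b, connected a b -> t a = t b).
{ intros a b ab; apply chosen_ext; intros c.
  assert (H : forall d, connected a d <-> connected b d).
  { intros d; split; intros H; eapply rst_trans; try eassumption.
    apply rst_sym; exact ab. }
  split; intros [H1 H2]; (split; [apply H; exact H1 |]);
    intros d Hd; apply H2, H, Hd. }
exists (fun G x => t (existT _ G x)), (fun G x => proj1_sig (u (existT _ G x))); split.
- intros G x; exact (proj2_sig (u (existT _ G x))).
- intros G D r x.
  pose (rr := exist _ r eq_refl : @Hom (Elements X) (existT _ D x.[r]) (existT _ G x)).
  assert (E : t (existT _ D x.[r]) = t (existT _ G x)).
  { apply hconn, rst_step; constructor; exact rr. }
  enough (H : existT (fun a : Elements X => Hom (existT _ D x.[r] : Elements X) a)
      (t (existT _ D x.[r])) (u (existT _ D x.[r])) = existT _ (t (existT _ G x))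
      (u (existT _ G x) \o rr)).
  + exact (f_equal (fun w : {a : Elements X & Hom (existT _ D x.[r] : Elements X) a} =>
      existT (fun a : EltOb X => Hom D (projT1 a)) (projT1 w) (proj1_sig (projT2 w))) H).
  + apply eq_over_existT.
    (* With the composite replaced by an arbitrary morphism [v], the target can be rewritten along
       [E]; terminality then leaves only one candidate for [v]. *)
    generalize (u (existT _ G x) \o rr) as v; rewrite <- E; intros v.
    rewrite (chosen_spec (hu (existT _ D x.[r])) v); apply eq_over_refl.
Qed.

(** The presheaf [X] is presented up to isomorphism by the types [Q] and the functions
    [qsub]; the functor laws of [Q] are inherited from [X]. *)
Lemma natural_section {C : Category} (X : Presheaf C) (gen : has_generics X)
    (Q : C -> Type) (qsub : forall G D, Hom D G -> Q G -> Q D)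
    (mk : forall G, Q G -> X G) (un : forall G, X G -> Q G)
    (un_mk : forall G q, un G (mk G q) = q) (mk_un : forall G x, mk G (un G x) = x)
    (mk_sub : forall G D (r : Hom D G) q, (mk G q).[r] = mk D (qsub G D r q))
    (F : forall G, Q G -> Type)
    (fsub : forall G D (r : Hom D G) q, F G q -> F D (qsub G D r q))
    (fsub_comp : forall G D E (r : Hom D G) (s : Hom E D) q (a : F G q),
      eq_over (F E) (fsub G E (r \o s) q a) (fsub D E s _ (fsub G D r q a)))
    (inh : forall G q, inhabited (F G q)) :
  exists sec : forall G q, F G q,
    forall G D (r : Hom D G) q, sec D (qsub G D r q) = fsub G D r q (sec G q).
Proof.
destruct gen as [t [u [ht hu]]].
(* An arbitrary element of [F] over each element of [X]; only its values at generic elements enter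
   the section. *)
pose (c := fun a : EltOb X => proj1_sig (constructive_indefinite_description (fun _ => True)
  match inh (projT1 a) (un _ (projT2 a)) with inhabits b => ex_intro _ b I end)).
assert (E : forall G q, qsub _ _ (u G (mk G q)) (un _ (projT2 (t G (mk G q)))) = q).
{ assert (un_sub : forall G D (r : Hom D G) x, un D x.[r] = qsub G D r (un G x)).
  { intros G D r x; rewrite <- (mk_un G x) at 1; rewrite mk_sub; apply un_mk. }
  intros G q; rewrite <- un_sub, ht; apply un_mk. }
exists (fun G q => cast (F G) (E G q) (fsub _ _ (u G (mk G q)) _ (c (t G (mk G q))))).
intros G D r q; apply eq_over_eq.
eapply eq_over_trans; [apply eq_over_castl |].
(* By [hu], restricting [q] along [r] keeps its generic element and replaces [u] by [u \o r];
   functoriality of [fsub] then splits the composite. *)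
apply eq_over_trans with (b := fsub _ _ (u G (mk G q) \o r) _ (c (t G (mk G q)))).
- apply existT_eq_over; rewrite <- mk_sub.
  exact (f_equal (fun w : {a : EltOb X & Hom D (projT1 a)} =>
    existT (F D) _ (fsub _ _ (projT2 w) _ (c (projT1 w)))) (hu G D r (mk G q))).
- eapply eq_over_trans; [apply fsub_comp |].
  generalize (E G q); generalize (fsub _ _ (u G (mk G q)) _ (c (t G (mk G q)))).
  intros a e; destruct e; apply eq_over_refl.
Qed.

(** * Weakly stable elimination *)

(** [K] and [z] are the pullbacks along [r] of [I] and of the substitution <id, x, rf>. *)
Record reindexes {C : CwF} {G D : C} (r : Hom D G) {A : Ty G} (x : Tm G A)
    (I : Ty (G ,, A)) {Y : Ty G} (rf : Tm G Y) {B : Ty D} (L : Hom (D ,, B) (G ,, A))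
    (K : Ty (D ,, B)) (z : Hom D (D ,, B ,, K)) : Prop := {
  rx_ty : B = A.[r];
  rx_pp : pp A \o L = r \o pp B;
  rx_qq : (qq A).{L} =~ qq B;
  rx_id : K = I.[L];
  rx_pt : pp B \o (pp K \o z) = idm D;
  rx_tm : (qq B).{pp K \o z} =~ x.{r};
  rx_refl : (qq K).{z} =~ rf.{r} }.

(** Existence of J and of a computation term, which runs from [d] to the value of J at [z], the
    direction of [wJbeta]. *)
Definition eliminates {C : CwF} (W : WeakIdIntro C) {D : C} {B : Ty D} (K : Ty (D ,, B))
    (z : Hom D (D ,, B ,, K)) : Prop :=
  forall (P : Ty (D ,, B ,, K)) (d : Tm D P.[z]),
    exists j : Tm (D ,, B ,, K) P, inhabited (Tm D (weq W d j.{z})).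

(** Elimination is required after every base change, so that the property itself survives
    substitution. Pullbacks are specified by equations because [A.[s].[r]] and [A.[s \o r]] are only
    propositionally equal. *)
Definition weakly_stable_elim {C : CwF} (W : WeakIdIntro C) {G : C} {A : Ty G} (x : Tm G A)
    (I : Ty (G ,, A)) {Y : Ty G} (rf : Tm G Y) : Prop :=
  forall (D : C) (r : Hom D G) (B : Ty D) (L : Hom (D ,, B) (G ,, A)) (K : Ty (D ,, B))
    (z : Hom D (D ,, B ,, K)),
    reindexes r x I rf L K z -> eliminates W K z.

Lemma tmsub_tmsub {C : CwF} {G D E : C} (r : Hom D G) (s : Hom E D) {A : Ty G}
    (a : Tm G A) : a.{r}.{s} =~ a.{r \o s}.
Proof. apply eq_over_sym, tmsub_comp. Qed.

(** The universal property of context extension forces [L] to be [lift r A] and [z] to be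
    [wk_refl_inst W x r], where [wJ] and [wJbeta] apply. *)
Lemma wId_weakly_stable_elim {C : CwF} (W : WeakId C) {G : C} {A : Ty G} (x : Tm G A) :
  weakly_stable_elim W x (wId W A x) (wrefl W A x).
Proof.
intros D r B L K z [eB Lp Lq eK zp zx zr]; subst B.
assert (E : L = lift r A).
{ apply hom_ext.
  - rewrite Lp; symmetry; apply pp_lift_along.
  - eapply eq_over_trans; [exact Lq | apply eq_over_sym, qq_lift_along]. }
subst L K; assert (E : z = wk_refl_inst W x r).
{ apply pair_uniq.
  - apply hom_ext; [rewrite pp_sect; exact zp |].
    eapply eq_over_trans; [exact zx | apply eq_over_sym, qq_sect].
  - eapply eq_over_trans; [exact zr | apply eq_over_castr]. }
subst z; intros P d; exists (wJ d); constructor; exact (wJbeta d).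
Qed.

(** A base change along [r] of the base change along [s] is a base change along [s \o r]. *)
Lemma weakly_stable_elim_sub {C : CwF} (W : WeakIdIntro C) {G D : C} (s : Hom D G)
    {A : Ty G} (x : Tm G A) (I : Ty (G ,, A)) {Y : Ty G} (rf : Tm G Y)
    {Y' : Ty D} (rf' : Tm D Y') :
  rf' =~ rf.{s} -> weakly_stable_elim W x I rf ->
  weakly_stable_elim W x.{s} I.[lift s A] rf'.
Proof.
intros Hrf H E r B L K z [eB Lp Lq eK zp zx zr].
apply (H E (s \o r) B (lift s A \o L)); constructor; trivial.
- rewrite restr_comp; exact eB.
- rewrite <- comp_assoc; unfold lift; rewrite pp_lift_along, comp_assoc, Lp, comp_assoc.
  reflexivity.
- eapply eq_over_trans; [apply tmsub_comp |].
  eapply eq_over_trans; [apply tmsub_eq_over, qq_lift_along | exact Lq].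
- rewrite restr_comp; exact eK.
- eapply eq_over_trans; [exact zx | apply tmsub_tmsub].
- eapply eq_over_trans; [exact zr |].
  eapply eq_over_trans; [apply tmsub_eq_over, Hrf | apply tmsub_tmsub].
Qed.

Lemma weakly_stable_elim_id {C : CwF} (W : WeakIdIntro C) {G : C} {A : Ty G} (x : Tm G A)
    (I : Ty (G ,, A)) {Y : Ty G} (rf : Tm G Y) (z : Hom G (G ,, A ,, I)) :
  weakly_stable_elim W x I rf -> pp I \o z = sect x -> (qq I).{z} =~ rf ->
  eliminates W I z.
Proof.
intros H zp zq; apply (H G (idm G) A (idm _)); constructor.
- symmetry; apply restr_id.
- rewrite comp_idl, comp_idr; reflexivity.
- apply tmsub_id.
- symmetry; apply restr_id.
- rewrite zp; apply pp_sect.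
- rewrite zp; eapply eq_over_trans; [apply qq_sect | apply eq_over_sym, tmsub_id].
- eapply eq_over_trans; [exact zq | apply eq_over_sym, tmsub_id].
Qed.

Lemma inhabited_Tm_eq {C : CwF} {G : C} {A B : Ty G} :
  A = B -> inhabited (Tm G A) -> inhabited (Tm G B).
Proof. intros e; destruct e; trivial. Qed.

(** Eliminate into [P] weakened to the identity type: this motive is [P] at [x] over [z] and [P] at
    [y] over the pair formed by [y] and [p]. *)
Lemma eliminates_transport {C : CwF} (W : WeakIdIntro C) {G : C} {A : Ty G} {x : Tm G A}
    {I : Ty (G ,, A)} {z : Hom G (G ,, A ,, I)} (y : Tm G A) (P : Ty (G ,, A)) :
  eliminates W I z -> pp I \o z = sect x -> inhabited (Tm G I.[sect y]) ->
  inhabited (Tm G P.[sect x]) -> inhabited (Tm G P.[sect y]).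
Proof.
intros H zp [p] [d].
assert (e : P.[sect x] = P.[pp I].[z]) by (rewrite <- restr_comp, zp; reflexivity).
destruct (H P.[pp I] (cast (Tm G) e d)) as [j _].
apply (@inhabited_Tm_eq C G P.[pp I].[pair I (sect y) p]).
- rewrite <- restr_comp, pp_pair; reflexivity.
- constructor; exact j.{pair I (sect y) p}.
Qed.

Lemma lift_pp_sect_qq {C : CwF} {G : C} (A : Ty G) : lift (pp A) A \o sect (qq A) = idm _.
Proof.
apply lift_along_pair.
- rewrite pp_sect, !comp_idr; reflexivity.
- eapply eq_over_trans; [apply qq_sect | apply eq_over_sym, tmsub_id].
Qed.

(** * Stable formation and introduction *)

Definition sort_ty (C : CwF) : NatTrans (TermPsh C) (MonoSort C) :=
  {| app := fun G _ => mono_ty tnil : MonoSort C G;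
     app_nat := fun _ _ _ _ => eq_refl |}.

Lemma eq_over_mono_tm {C : CwF} {G : C} {A B : Ty G} (a : Tm G A) (b : Tm G B) :
  a =~ b ->
  eq_over MonoElem (a : MonoElem (mono_tm tnil A)) (b : MonoElem (mono_tm tnil B)).
Proof. intros [e H]; destruct e; destruct H; apply eq_over_refl. Qed.

Definition mk_ty {C : CwF} {G : C} (A : Ty G) : ext_psh (sort_ty C) G :=
  existT (fun e => MonoElem (sort_ty C G e)) tt A.

Lemma mk_ty_sub {C : CwF} {G D : C} (r : Hom D G) (A : Ty G) :
  (mk_ty A).[r] = mk_ty A.[r].
Proof. apply ext_psh_eq; [reflexivity | apply eq_over_castl]. Qed.

Lemma sort_tm_nat {C : CwF} (G D : C) (r : Hom D G) (u : ext_psh (sort_ty C) G) :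
  mono_tm tnil (projT2 u.[r]) = mono_sub r (mono_tm tnil (projT2 u)).
Proof.
destruct u as [[] A]; exact (f_equal (fun v : ext_psh (sort_ty C) D =>
  mono_tm tnil (projT2 v)) (mk_ty_sub r A)).
Qed.

Definition sort_tm (C : CwF) : NatTrans (ext_psh (sort_ty C)) (MonoSort C) :=
  {| app := fun G (u : ext_psh (sort_ty C) G) => mono_tm tnil (projT2 u) : MonoSort C G;
     app_nat := @sort_tm_nat C |}.

(** A direct presentation of the elements of [ext_psh (sort_tm C)], with a restriction free of
    transports. *)
Definition Intro {C : CwF} (G : C) : Type := {A : Ty G & Tm G A}.

Definition intro_sub {C : CwF} (G D : C) (r : Hom D G) (u : Intro G) : Intro D :=
  existT (Tm D) (projT1 u).[r] (projT2 u).{r}.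

Definition mk_intro {C : CwF} (G : C) (u : Intro G) : ext_psh (sort_tm C) G :=
  existT (fun e => MonoElem (sort_tm C G e)) (mk_ty (projT1 u)) (projT2 u).

Definition un_intro {C : CwF} (G : C) (v : ext_psh (sort_tm C) G) : Intro G :=
  existT (Tm G) (projT2 (projT1 v)) (projT2 v).

Lemma un_mk_intro {C : CwF} (G : C) (u : Intro G) : un_intro G (mk_intro G u) = u.
Proof. destruct u; reflexivity. Qed.

Lemma mk_un_intro {C : CwF} (G : C) (v : ext_psh (sort_tm C) G) :
  mk_intro G (un_intro G v) = v.
Proof. destruct v as [[[] A] x]; reflexivity. Qed.

Lemma mk_intro_sub {C : CwF} (G D : C) (r : Hom D G) (u : Intro G) :
  (mk_intro G u).[r] = mk_intro D (intro_sub G D r u).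
Proof.
apply ext_psh_eq; [apply mk_ty_sub |].
eapply eq_over_trans; [apply eq_over_castl | apply eq_over_refl].
Qed.

Lemma intro_generics {C : CwF} (hC : has_familially_representable_poly_sorts C) :
  has_generics (ext_psh (sort_tm C)).
Proof.
apply familially_representable_has_generics.
exact (hC {| poly_code := poly_snoc (poly_snoc poly_nil (sort_ty C)) (sort_tm C) |}).
Qed.

(** The proof of elimination is part of the data, so that whatever is restricted from a generic pair
    still eliminates. *)
Definition IdData {C : CwF} (W : WeakIdIntro C) (G : C) (u : Intro G) : Type :=
  {I : Ty (G ,, projT1 u) &
    {rf : Tm G I.[sect (projT2 u)] | weakly_stable_elim W (projT2 u) I rf}}.

Lemma sect_sub_ty {C : CwF} {G D : C} (r : Hom D G) {A : Ty G} (I : Ty (G ,, A))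
    (y : Tm G A) : I.[sect y].[r] = I.[lift r A].[sect y.{r}].
Proof. rewrite <- !restr_comp, sect_nat; reflexivity. Qed.

Definition id_data_sub {C : CwF} (W : WeakIdIntro C) (G D : C) (r : Hom D G)
    (u : Intro G) (a : IdData W G u) : IdData W D (intro_sub G D r u) :=
  existT (fun I : Ty (D ,, (projT1 u).[r]) =>
      {rf : Tm D I.[sect (projT2 u).{r}] | weakly_stable_elim W (projT2 u).{r} I rf})
    (projT1 a).[lift r (projT1 u)]
    (exist _ (cast (Tm D) (sect_sub_ty r (projT1 a) (projT2 u)) (proj1_sig (projT2 a)).{r})
      (weakly_stable_elim_sub W r _ _ _ _
        (eq_over_castl _ _) (proj2_sig (projT2 a)))).

Lemma id_data_eq {C : CwF} (W : WeakIdIntro C) {G : C} (u v : Intro G)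
    (a : IdData W G u) (b : IdData W G v) :
  u = v ->
  existT (fun A : Ty G => Ty (G ,, A)) (projT1 u) (projT1 a)
    = existT _ (projT1 v) (projT1 b) ->
  proj1_sig (projT2 a) =~ proj1_sig (projT2 b) -> eq_over (IdData W G) a b.
Proof.
intros e; destruct e; destruct a as [I [rf H]], b as [I' [rf' H']]; simpl.
intros E; apply inj_pair2 in E; destruct E.
intros E; apply eq_over_eq in E; destruct E.
rewrite (proof_irrelevance _ H H'); apply eq_over_refl.
Qed.

Lemma id_data_sub_comp {C : CwF} (W : WeakIdIntro C) (G D E : C) (r : Hom D G)
    (s : Hom E D) (u : Intro G) (a : IdData W G u) :
  eq_over (IdData W E) (id_data_sub W G E (r \o s) u a)
    (id_data_sub W D E s _ (id_data_sub W G D r u a)).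
Proof.
apply id_data_eq.
- apply eq_over_existT, tmsub_comp.
- simpl; rewrite <- (restr_comp (lift r (projT1 u))
    (lift s (projT1 u).[r]) (projT1 a)).
  exact (f_equal (fun w : {B : Ty E & Hom (E ,, B) (G ,, projT1 u)} =>
    existT (fun A : Ty E => Ty (E ,, A)) (projT1 w) (projT1 a).[projT2 w])
    (lift_comp r s (projT1 u))).
- simpl; eapply eq_over_trans; [apply eq_over_castl |].
  eapply eq_over_trans; [| apply eq_over_castr].
  eapply eq_over_trans; [apply tmsub_comp |].
  apply tmsub_eq_over, eq_over_castr.
Qed.

Lemma stable_id_intro {C : CwF} (W : WeakId C)
    (hC : has_familially_representable_poly_sorts C) :
  exists S : StableIdIntro C, forall (G : C) (A : Ty G) (x : Tm G A),
    weakly_stable_elim W x (pId S A x) (srefl S A x).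
Proof.
destruct (natural_section _ (intro_generics hC) Intro intro_sub mk_intro un_intro
  un_mk_intro mk_un_intro mk_intro_sub (IdData W) (id_data_sub W)
  (id_data_sub_comp W)) as [sec Hsec].
(* The weakly stable structure supplies the data over each pair. *)
{ intros G [A x]; constructor; exists (wId W A x), (wrefl W A x).
  apply wId_weakly_stable_elim. }
pose (I := fun (G : C) (A : Ty G) (x : Tm G A) => projT1 (sec G (existT _ A x))).
pose (rf := fun (G : C) (A : Ty G) (x : Tm G A) => proj1_sig (projT2 (sec G (existT _ A x)))).
assert (I_sub : forall (G D : C) (r : Hom D G) (A : Ty G) (x : Tm G A),
    I D A.[r] x.{r} = (I G A x).[lift r A]).
{ intros; exact (f_equal (@projT1 _ _) (Hsec G D r (existT _ A x))). }
assert (rf_sub : forall (G D : C) (r : Hom D G) (A : Ty G) (x : Tm G A),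
    (rf G A x).{r} =~ rf D A.[r] x.{r}).
{ intros; apply eq_over_sym.
  apply eq_over_trans with
    (b := proj1_sig (projT2 (id_data_sub W G D r _ (sec G (existT _ A x))))).
  - rewrite <- Hsec; apply eq_over_refl.
  - apply eq_over_castl. }
(* The chosen family is based at [x]; the second endpoint enters by instantiation. *)
pose (id := fun (G : C) (A : Ty G) (x y : Tm G A) => (I G A x).[sect y]).
assert (id_sub : forall (G D : C) (r : Hom D G) (A : Ty G) (x y : Tm G A),
    (id G A x y).[r] = id D A.[r] x.{r} y.{r}).
{ intros; unfold id; rewrite I_sub; apply sect_sub_ty. }
pose (S0 := @Build_StableIdForm C id id_sub).
(* Naturality along [pp A] turns the family at the weakened [x] into [I] pulled back along
   [lift (pp A) A], and instantiating at [qq A] undoes this pullback. *)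
assert (pId_I : forall (G : C) (A : Ty G) (x : Tm G A), pId S0 A x = I G A x).
{ intros G A x; change (pId S0 A x) with (I _ A.[pp A] x.{pp A}).[sect (qq A)].
  rewrite I_sub, <- restr_comp, lift_pp_sect_qq; apply restr_id. }
exists (@Build_StableIdIntro C S0 rf rf_sub); intros G A x.
change (weakly_stable_elim W x (pId S0 A x) (rf G A x)).
rewrite pId_I; exact (proj2_sig (projT2 (sec G (existT _ A x)))).
Qed.

(** * Consequences of elimination *)

Definition weakly_stable_elims {C : CwF} (W : WeakIdIntro C) (S : StableIdIntro C) : Prop :=
  forall (G : C) (A : Ty G) (x : Tm G A),
    weakly_stable_elim W x (pId S A x) (srefl S A x).

Lemma pp_st_refl_inst {C : CwF} (S : StableIdIntro C) {G : C} {A : Ty G} (x : Tm G A) :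
  pp (pId S A x) \o st_refl_inst S x = sect x.
Proof. apply pp_pair. Qed.

Lemma qq_st_refl_inst {C : CwF} (S : StableIdIntro C) {G : C} {A : Ty G} (x : Tm G A) :
  (qq (pId S A x)).{st_refl_inst S x} =~ srefl S A x.
Proof. eapply eq_over_trans; [apply qq_pair | apply eq_over_castl]. Qed.

Lemma st_refl_inst_eliminates {C : CwF} {W : WeakIdIntro C} {S : StableIdIntro C}
    (hS : weakly_stable_elims W S) {G : C} {A : Ty G} (x : Tm G A) :
  eliminates W (pId S A x) (st_refl_inst S x).
Proof.
eapply weakly_stable_elim_id; [apply hS | apply pp_st_refl_inst | apply qq_st_refl_inst].
Qed.

(** The substitution <id, x, refl> over [A] itself; [wk_refl_inst] at the identity would land over
    [A.[idm G]]. *)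
Definition wrefl_inst {C : CwF} (W : WeakIdIntro C) {G : C} {A : Ty G} (x : Tm G A) :
    Hom G (G ,, A ,, wId W A x) :=
  pair _ (sect x) (wrefl W A x).

Lemma wrefl_inst_eliminates {C : CwF} (W : WeakId C) {G : C} {A : Ty G} (x : Tm G A) :
  eliminates W (wId W A x) (wrefl_inst W x).
Proof.
eapply weakly_stable_elim_id;
  [apply wId_weakly_stable_elim | apply pp_pair | apply qq_pair].
Qed.

(** Transport [srefl S A x] along the weak identification. *)
Lemma weq_sId {C : CwF} (W : WeakId C) (S : StableIdIntro C) {G : C} {A : Ty G}
    (x y : Tm G A) : inhabited (Tm G (weq W x y)) -> inhabited (Tm G (sId S A x y)).
Proof.
intros p; rewrite pId_sect.
refine (eliminates_transport W y _ (wrefl_inst_eliminates W x) (pp_pair _) p _).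
rewrite <- pId_sect; constructor; apply srefl.
Qed.

Lemma sId_transport {C : CwF} {W : WeakIdIntro C} {S : StableIdIntro C}
    (hS : weakly_stable_elims W S) {G : C} {A : Ty G} (x y : Tm G A) (P : Ty (G ,, A)) :
  inhabited (Tm G (sId S A x y)) -> inhabited (Tm G P.[sect x]) ->
  inhabited (Tm G P.[sect y]).
Proof.
rewrite pId_sect.
exact (eliminates_transport W y P (st_refl_inst_eliminates hS x) (pp_st_refl_inst S x)).
Qed.

Lemma sId_weq {C : CwF} {W : WeakIdIntro C} {S : StableIdIntro C}
    (hS : weakly_stable_elims W S) {G : C} {A : Ty G} (x y : Tm G A) :
  inhabited (Tm G (sId S A x y)) -> inhabited (Tm G (weq W x y)).
Proof.
intros p; apply (sId_transport hS x y (wId W A x) p); constructor; apply wrefl.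
Qed.

Lemma tmsub_pp_sect {C : CwF} {G : C} {A B : Ty G} (a : Tm G A) (b : Tm G B) :
  b.{pp A}.{sect a} =~ b.
Proof.
eapply eq_over_trans; [apply tmsub_tmsub |].
rewrite pp_sect; apply tmsub_id.
Qed.

(** Transport reflexivity in the family of identifications of a varying point with [x]. *)
Lemma sId_sym {C : CwF} {W : WeakIdIntro C} {S : StableIdIntro C}
    (hS : weakly_stable_elims W S) {G : C} {A : Ty G} (x y : Tm G A) :
  inhabited (Tm G (sId S A x y)) -> inhabited (Tm G (sId S A y x)).
Proof.
intros p.
assert (E : forall z : Tm G A, (sId S A.[pp A] (qq A) x.{pp A}).[sect z] = sId S A z x).
{ intros z; rewrite sId_sub; apply sId_eq; [apply qq_sect | apply tmsub_pp_sect]. }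
rewrite <- E; apply (sId_transport hS x y _ p).
rewrite E; constructor; apply srefl.
Qed.

(** Elimination yields a weak identification from [d] to J at reflexivity; it is mapped into the
    strict identity type and then reversed, as [sJbeta] ends at [d]. *)
Lemma stable_J_exists {C : CwF} {W : WeakId C} {S : StableIdIntro C}
    (hS : weakly_stable_elims W S) {G : C} {A : Ty G} (x : Tm G A)
    (P : Ty (G ,, A ,, pId S A x)) (d : Tm G P.[st_refl_inst S x]) :
  exists j : Tm _ P,
    inhabited (Tm G (sId S P.[st_refl_inst S x] j.{st_refl_inst S x} d)).
Proof.
destruct (st_refl_inst_eliminates hS x P d) as [j Hj].
exists j; apply (sId_sym hS), (weq_sId W), Hj.
Qed.

(** Both [f] and its homotopy inverse come from this lemma, applied with the roles of [B]
    and [B'] exchanged. *)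
Lemma eliminates_map {C : CwF} {W : WeakId C} (S : StableIdIntro C)
    {G : C} {A : Ty G} {x : Tm G A} {B B' : Ty (G ,, A)}
    {z : Hom G (G ,, A ,, B)} {z' : Hom G (G ,, A ,, B')} :
  eliminates W B z -> pp B \o z = sect x -> pp B' \o z' = sect x ->
  exists f : Tm (G ,, A ,, B) B'.[pp B],
    forall (a b : Tm G B'.[sect x]), a =~ (qq B').{z'} -> b =~ f.{z} ->
      inhabited (Tm G (sId S _ a b)).
Proof.
intros H zp zp'.
assert (e : B'.[pp B'].[z'] = B'.[pp B].[z]) by (rewrite <- !restr_comp, zp, zp'; reflexivity).
(* The method is the base point of [B'], so the computation rule identifies [f] at [z] with that
   base point. *)
destruct (H B'.[pp B] (cast (Tm G) e (qq B').{z'})) as [f Hf].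
exists f; intros a b Ha Hb; apply (weq_sId W S) in Hf.
refine (inhabited_Tm_eq _ Hf); apply sId_eq; apply eq_over_sym; [| exact Hb].
eapply eq_over_trans; [exact Ha | apply eq_over_castr].
Qed.

(** By elimination on [B] it suffices to treat the base point [z]. There [f] gives the base point of
    [B'] up to identity, and [g] takes that back to the base point of [B]. *)
Lemma eliminates_homotopy {C : CwF} {W : WeakId C} {S : StableIdIntro C}
    (hS : weakly_stable_elims W S) {G : C} {A : Ty G} {x : Tm G A} {B B' : Ty (G ,, A)}
    {z : Hom G (G ,, A ,, B)} {z' : Hom G (G ,, A ,, B')}
    (f : Tm (G ,, A ,, B) B'.[pp B]) (g : Tm (G ,, A ,, B') B.[pp B']) :
  eliminates W B z -> pp B \o z = sect x -> pp B' \o z' = sect x ->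
  (forall (a b : Tm G B'.[sect x]), a =~ (qq B').{z'} -> b =~ f.{z} ->
     inhabited (Tm G (sId S _ a b))) ->
  (forall (a b : Tm G B.[sect x]), a =~ (qq B).{z} -> b =~ g.{z'} ->
     inhabited (Tm G (sId S _ a b))) ->
  inhabited (Tm (G ,, A ,, B) (weq W (map_comp g f) (qq B))).
Proof.
intros H zp zp' Hf Hg; apply (sId_weq hS).
assert (eB : B.[pp B].[z] = B.[sect x]) by (rewrite <- restr_comp, zp; reflexivity).
assert (eB' : B'.[pp B'].[z'] = B'.[sect x]) by (rewrite <- restr_comp, zp'; reflexivity).
assert (ef : B'.[pp B].[z] = B'.[sect x]) by (rewrite <- restr_comp, zp; reflexivity).
assert (eg : B.[pp B'].[z'] = B.[sect x]) by (rewrite <- restr_comp, zp'; reflexivity).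
pose (c0 := cast (Tm G) eB (qq B).{z}); pose (c1 := cast (Tm G) eg g.{z'}).
pose (a0 := cast (Tm G) eB' (qq B').{z'}); pose (a1 := cast (Tm G) ef f.{z}).
set (B0 := B.[sect x]) in *; set (B0' := B'.[sect x]) in *.
assert (hg : B.[pp B'].[lift (sect x) B'] = B0.[pp B0']).
{ unfold lift, B0; rewrite <- !restr_comp, pp_lift_along; reflexivity. }
(* [R] at a point [a] of the fibre of [B'] over [x] says that [g] at [a] is the base point of
   [B]. *)
pose (R := sId S B0.[pp B0'] (cast (Tm _) hg g.{lift (sect x) B'}) c0.{pp B0'}).
assert (R_sect : forall (a : Tm G B0') (h : Hom G (G ,, A ,, B')) (b : Tm G B0),
    pp B' \o h = sect x -> (qq B').{h} =~ a -> b =~ g.{h} -> R.[sect a] = sId S B0 b c0).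
{ intros a h b hp hq hb; unfold R; rewrite sId_sub; apply sId_eq; [| apply tmsub_pp_sect].
  eapply eq_over_trans; [apply tmsub_eq_over, eq_over_castl |].
  eapply eq_over_trans; [apply tmsub_tmsub |].
  apply eq_over_sym; eapply eq_over_trans; [exact hb |].
  apply tmsub_eq_hom; symmetry; apply lift_along_pair.
  - rewrite pp_sect, comp_idr; symmetry; exact hp.
  - eapply eq_over_trans; [apply qq_sect | apply eq_over_sym; exact hq]. }
(* Transport in [R] from the base point [a0] of [B'] to its identified copy [a1], the value of [f];
   at [a0] the claim is the inverse of [Hg]. *)
assert (hmap : inhabited (Tm G R.[sect a1])).
{ apply (sId_transport hS a0).
  - apply Hf; apply eq_over_castl.
  - rewrite (R_sect a0 z' c1); trivial; try apply eq_over_castl; try apply eq_over_castr.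
    apply (sId_sym hS), Hg; apply eq_over_castl. }
pose (c2 := cast (Tm G) eB (map_comp g f).{z}).
assert (E : sId S B0 c2 c0 = (sId S _ (map_comp g f) (qq B)).[z]).
{ rewrite sId_sub; apply sId_eq; apply eq_over_castl. }
(* [R] at [a1] is the desired homotopy at [z], which serves as the method of the final
   elimination. *)
rewrite (R_sect a1 (pair B' (pp B) f \o z) c2), E in hmap.
- destruct hmap as [d]; destruct (H _ d) as [j _]; constructor; exact j.
- rewrite <- comp_assoc, pp_pair; exact zp.
- eapply eq_over_trans; [apply tmsub_comp |].
  eapply eq_over_trans; [apply tmsub_eq_over, qq_pair | apply eq_over_castr].
- eapply eq_over_trans; [apply eq_over_castl |].
  eapply eq_over_trans; [apply tmsub_eq_over, eq_over_castl | apply tmsub_tmsub].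
Qed.

Lemma equivalent_to_weak {C : CwF} (W : WeakId C) (S : StableIdIntro C)
    (hS : weakly_stable_elims W S) {G : C} {A : Ty G} (x : Tm G A) :
  equivalent_types W (pId S A x) (wId W A x).
Proof.
pose proof (st_refl_inst_eliminates hS x) as E.
pose proof (pp_st_refl_inst S x) as zp.
pose proof (wrefl_inst_eliminates W x) as E'.
assert (zp' : pp (wId W A x) \o wrefl_inst W x = sect x) by apply pp_pair.
destruct (eliminates_map S E zp zp') as [f Hf].
destruct (eliminates_map S E' zp' zp) as [g Hg].
exists f, g; split.
- exact (eliminates_homotopy hS f g E zp zp' Hf Hg).
- exact (eliminates_homotopy hS g f E' zp' zp Hg Hf).
Qed.

(** * Stable elimination *)

Definition id_ctx {C : CwF} (S : StableIdForm C) {G : C} (u : Intro G) : C :=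
  G ,, projT1 u ,, pId S (projT1 u) (projT2 u).

(** The three equations determine [L] as the lift of [r]. *)
Record is_id_lift {C : CwF} (S : StableIdForm C) {G D : C} (r : Hom D G) (u : Intro G)
    (v : Intro D) (L : Hom (id_ctx S v) (id_ctx S u)) : Prop := {
  il_pp : pp _ \o (pp _ \o L) = r \o pp _ \o pp (pId S (projT1 v) (projT2 v));
  il_qp : (qq _).{pp _ \o L} =~ (qq _).{pp (pId S (projT1 v) (projT2 v))};
  il_qq : (qq _).{L} =~ qq (pId S (projT1 v) (projT2 v)) }.

Lemma st_lift_is_id_lift {C : CwF} (S : StableIdIntro C) {G D : C} (r : Hom D G)
    (u : Intro G) : is_id_lift S r u (intro_sub G D r u) (st_lift S r (projT2 u)).
Proof.
destruct u as [A x]; constructor; unfold id_ctx, intro_sub, st_lift; simpl.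
- rewrite pp_lift_along, <- comp_assoc; unfold lift; rewrite pp_lift_along; reflexivity.
- rewrite pp_lift_along; eapply eq_over_trans; [apply tmsub_comp |].
  apply tmsub_eq_over, qq_lift_along.
- apply qq_lift_along.
Qed.

Lemma is_id_lift_comp {C : CwF} (S : StableIdForm C) {G D E : C} (r : Hom D G)
    (s : Hom E D) (u : Intro G) (v : Intro D) (w : Intro E)
    (L : Hom (id_ctx S v) (id_ctx S u)) (M : Hom (id_ctx S w) (id_ctx S v)) :
  is_id_lift S r u v L -> is_id_lift S s v w M -> is_id_lift S (r \o s) u w (L \o M).
Proof.
unfold id_ctx in *; intros [L1 L2 L3] [M1 M2 M3]; constructor; unfold id_ctx in *.
- rewrite <- !comp_assoc in *; rewrite L1.
  rewrite !comp_assoc in *; rewrite M1; reflexivity.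
- rewrite <- comp_assoc; eapply eq_over_trans; [apply tmsub_comp |].
  eapply eq_over_trans; [apply tmsub_eq_over, L2 |].
  eapply eq_over_trans; [apply tmsub_tmsub | exact M2].
- eapply eq_over_trans; [apply tmsub_comp |].
  eapply eq_over_trans; [apply tmsub_eq_over, L3 | exact M3].
Qed.

Lemma is_id_lift_unique {C : CwF} (S : StableIdForm C) {G D : C} (r : Hom D G)
    (u : Intro G) (v v' : Intro D) (L : Hom (id_ctx S v) (id_ctx S u))
    (L' : Hom (id_ctx S v') (id_ctx S u)) :
  v = v' -> is_id_lift S r u v L -> is_id_lift S r u v' L' ->
  existT (fun v => Hom (id_ctx S v) (id_ctx S u)) v L = existT _ v' L'.
Proof.
intros e; destruct e; intros [L1 L2 L3] [M1 M2 M3]; f_equal.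
apply hom_ext; [apply hom_ext |].
- rewrite L1, M1; reflexivity.
- eapply eq_over_trans; [exact L2 | apply eq_over_sym, M2].
- eapply eq_over_trans; [exact L3 | apply eq_over_sym, M3].
Qed.

(** Both sides lift [r \o s], and lifts are unique, so the casts inside [st_lift] need not be
    computed. *)
Lemma st_lift_comp {C : CwF} (S : StableIdIntro C) {G D E : C} (r : Hom D G)
    (s : Hom E D) (u : Intro G) :
  existT (fun v => Hom (id_ctx S v) (id_ctx S u)) (intro_sub G E (r \o s) u)
    (st_lift S (r \o s) (projT2 u))
  = existT _ (intro_sub D E s (intro_sub G D r u))
      (st_lift S r (projT2 u) \o st_lift S s (projT2 u).{r}).
Proof.
apply (is_id_lift_unique S (r \o s)).
- apply eq_over_existT, tmsub_comp.
- apply st_lift_is_id_lift.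
- exact (is_id_lift_comp S r s _ _ _ _ _ (st_lift_is_id_lift S r u)
    (st_lift_is_id_lift S s (intro_sub G D r u))).
Qed.

(** * The polynomial sort of elimination data (A, x, P, d) *)

Lemma un_intro_sub {C : CwF} (G D : C) (r : Hom D G) (v : ext_psh (sort_tm C) G) :
  un_intro D v.[r] = intro_sub G D r (un_intro G v).
Proof. rewrite <- (mk_un_intro G v) at 1; rewrite mk_intro_sub; apply un_mk_intro. Qed.

Definition motive_mono {C : CwF} (S : StableIdForm C) {G : C} (u : Intro G) : Mono G :=
  mono_ty (tcons (projT1 u) (tcons (pId S (projT1 u) (projT2 u)) tnil)).

Lemma sort_motive_nat {C : CwF} (S : StableIdForm C) (G D : C) (r : Hom D G)
    (v : ext_psh (sort_tm C) G) :
  motive_mono S (un_intro D v.[r]) = mono_sub r (motive_mono S (un_intro G v)).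
Proof. rewrite un_intro_sub; unfold motive_mono; simpl; rewrite pId_sub; reflexivity. Qed.

Definition sort_motive {C : CwF} (S : StableIdForm C) :
    NatTrans (ext_psh (sort_tm C)) (MonoSort C) :=
  {| app := fun G (v : ext_psh (sort_tm C) G) =>
       motive_mono S (un_intro G v) : MonoSort C G;
     app_nat := sort_motive_nat S |}.

Definition mk_motive {C : CwF} (S : StableIdForm C) {G : C} (u : Intro G)
    (P : Ty (id_ctx S u)) : ext_psh (sort_motive S) G :=
  existT (fun e => MonoElem (sort_motive S G e)) (mk_intro G u) P.

Lemma mk_motive_sub {C : CwF} (S : StableIdIntro C) {G D : C} (r : Hom D G) (u : Intro G)
    (P : Ty (id_ctx S u)) :
  (mk_motive S u P).[r]
  = mk_motive S (intro_sub G D r u) P.[st_lift S r (projT2 u)].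
Proof.
apply ext_psh_eq; [apply mk_intro_sub |].
eapply eq_over_trans; [apply eq_over_castl |].
(* The restricted telescope entry equals [pId S] of the restricted pair only propositionally; with
   [K] free, the equation can be eliminated. *)
enough (H : forall K (e : K = (pId S (projT1 u) (projT2 u)).[lift r (projT1 u)]),
  eq_over MonoElem (mono_elem_sub r (P : MonoElem (motive_mono S u)))
    (P.[lift_along e] : MonoElem (mono_ty (tcons _ (tcons K tnil)))))
  by exact (H _ (pId_sub S r (projT2 u))).
intros K e; subst K; apply eq_over_refl.
Qed.

Definition motive_at_refl {C : CwF} (S : StableIdIntro C) {G : C}
    (v : ext_psh (sort_motive S) G) : Ty G :=
  (projT2 v : Ty (id_ctx S (un_intro G (projT1 v)))).[st_refl_inst S _].

Lemma sort_method_nat {C : CwF} (S : StableIdIntro C) (G D : C) (r : Hom D G)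
    (v : ext_psh (sort_motive S) G) :
  mono_tm tnil (motive_at_refl S v.[r]) = mono_sub r (mono_tm tnil (motive_at_refl S v)).
Proof.
destruct v as [v P]; revert P; rewrite <- (mk_un_intro G v); intros P.
change (existT _ (mk_intro G (un_intro G v)) P) with (mk_motive S (un_intro G v) P).
rewrite mk_motive_sub; simpl; f_equal; symmetry; apply st_motive_sub.
Qed.

Definition sort_method {C : CwF} (S : StableIdIntro C) :
    NatTrans (ext_psh (sort_motive S)) (MonoSort C) :=
  {| app := fun G v => mono_tm tnil (motive_at_refl S v) : MonoSort C G;
     app_nat := @sort_method_nat C S |}.

(** Elements of [ext_psh (sort_method S)] in the form of the arguments of [sJ], so that [elim_sub]
    is the substitution occurring in [sJ_sub] and [sJbeta_sub]. *)
Record Elim {C : CwF} (S : StableIdIntro C) (G : C) : Type := mkElim {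
  el_intro : Intro G;
  el_motive : Ty (id_ctx S el_intro);
  el_method : Tm G el_motive.[st_refl_inst S (projT2 el_intro)] }.

Arguments mkElim {C} S {G} _ _ _.
Arguments el_intro {C S G} _.
Arguments el_motive {C S G} _.
Arguments el_method {C S G} _.

Definition elim_sub {C : CwF} (S : StableIdIntro C) (G D : C) (r : Hom D G)
    (q : Elim S G) : Elim S D :=
  mkElim S (intro_sub G D r (el_intro q)) (el_motive q).[st_lift S r (projT2 (el_intro q))]
    (st_method_sub r (el_method q)).

Definition mk_elim {C : CwF} (S : StableIdIntro C) (G : C) (q : Elim S G) :
    ext_psh (sort_method S) G :=
  existT (fun e => MonoElem (sort_method S G e)) (mk_motive S (el_intro q) (el_motive q))
    (el_method q).

Definition un_elim {C : CwF} (S : StableIdIntro C) (G : C)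
    (v : ext_psh (sort_method S) G) : Elim S G :=
  mkElim S (un_intro G (projT1 (projT1 v))) (projT2 (projT1 v)) (projT2 v).

Lemma un_mk_elim {C : CwF} (S : StableIdIntro C) (G : C) (q : Elim S G) :
  un_elim S G (mk_elim S G q) = q.
Proof. destruct q as [[A x] P d]; reflexivity. Qed.

Lemma mk_un_elim {C : CwF} (S : StableIdIntro C) (G : C) (v : ext_psh (sort_method S) G) :
  mk_elim S G (un_elim S G v) = v.
Proof. destruct v as [[[[[] A] x] P] d]; reflexivity. Qed.

Lemma mk_elim_sub {C : CwF} (S : StableIdIntro C) (G D : C) (r : Hom D G) (q : Elim S G) :
  (mk_elim S G q).[r] = mk_elim S D (elim_sub S G D r q).
Proof.
destruct q as [[A x] P d]; apply ext_psh_eq; [apply mk_motive_sub |].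
eapply eq_over_trans; [apply eq_over_castl |].
refine (eq_over_mono_tm _ _ _); apply eq_over_castr.
Qed.

Lemma elim_generics {C : CwF} (hC : has_familially_representable_poly_sorts C)
    (S : StableIdIntro C) : has_generics (ext_psh (sort_method S)).
Proof.
apply familially_representable_has_generics.
exact (hC {| poly_code := poly_snoc (poly_snoc (poly_snoc (poly_snoc poly_nil
  (sort_ty C)) (sort_tm C)) (sort_motive S)) (sort_method S) |}).
Qed.

(** * Natural choice of J and its computation term *)

Definition JType {C : CwF} (S : StableIdIntro C) {G : C} (q : Elim S G)
    (j : Tm _ (el_motive q)) : Ty G :=
  sId S _ j.{st_refl_inst S (projT2 (el_intro q))} (el_method q).

(** J and its computation term are chosen together because the type of the latter mentions the
    former. *)
Definition JData {C : CwF} (S : StableIdIntro C) (G : C) (q : Elim S G) : Type :=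
  {j : Tm _ (el_motive q) & Tm G (JType S q j)}.

Lemma JType_sub {C : CwF} (S : StableIdIntro C) (G D : C) (r : Hom D G) (q : Elim S G)
    (j : Tm _ (el_motive q)) :
  (JType S q j).[r]
  = JType S (elim_sub S G D r q) j.{st_lift S r (projT2 (el_intro q))}.
Proof.
unfold JType; rewrite sId_sub; apply sId_eq.
- eapply eq_over_trans; [apply tmsub_tmsub |].
  rewrite st_refl_inst_nat; apply tmsub_comp.
- apply eq_over_castr.
Qed.

Definition j_data_sub {C : CwF} (S : StableIdIntro C) (G D : C) (r : Hom D G)
    (q : Elim S G) (a : JData S G q) : JData S D (elim_sub S G D r q) :=
  existT (fun j => Tm D (JType S (elim_sub S G D r q) j))
    (projT1 a).{st_lift S r (projT2 (el_intro q))}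
    (cast (Tm D) (JType_sub S G D r q (projT1 a)) (projT2 a).{r}).

Lemma j_data_eq {C : CwF} (S : StableIdIntro C) {G : C} (q q' : Elim S G)
    (a : JData S G q) (a' : JData S G q') :
  existT (fun u => {P : Ty (id_ctx S u) & Tm _ P}) (el_intro q)
    (existT (Tm _) (el_motive q) (projT1 a))
  = existT _ (el_intro q') (existT (Tm _) (el_motive q') (projT1 a')) ->
  el_method q =~ el_method q' -> projT2 a =~ projT2 a' -> eq_over (JData S G) a a'.
Proof.
destruct q as [u P d], q' as [u' P' d'], a as [j b], a' as [j' b']; simpl in *.
intros E; assert (e : u = u') by exact (f_equal (@projT1 _ _) E); destruct e.
apply inj_pair2 in E.
assert (e : P = P') by exact (f_equal (@projT1 _ _) E); destruct e.
apply inj_pair2 in E; destruct E.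
intros E; apply eq_over_eq in E; destruct E.
intros E; apply eq_over_eq in E; destruct E.
apply eq_over_refl.
Qed.

Lemma j_data_sub_comp {C : CwF} (S : StableIdIntro C) (G D E : C) (r : Hom D G)
    (s : Hom E D) (q : Elim S G) (a : JData S G q) :
  eq_over (JData S E) (j_data_sub S G E (r \o s) q a)
    (j_data_sub S D E s _ (j_data_sub S G D r q a)).
Proof.
apply j_data_eq; simpl.
- transitivity (existT (fun u => {P : Ty (id_ctx S u) & Tm _ P})
    (intro_sub D E s (intro_sub G D r (el_intro q)))
    (existT (Tm _) _ (projT1 a).{st_lift S r (projT2 (el_intro q))
       \o st_lift S s (projT2 (el_intro q)).{r}})).
  + exact (f_equal (fun w : {v : Intro E & Hom (id_ctx S v) (id_ctx S (el_intro q))} =>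
      existT (fun u => {P : Ty (id_ctx S u) & Tm _ P}) (projT1 w)
        (existT (Tm _) _ (projT1 a).{projT2 w})) (st_lift_comp S r s (el_intro q))).
  + f_equal; apply eq_over_existT, tmsub_comp.
- eapply eq_over_trans; [apply eq_over_castl |].
  eapply eq_over_trans; [| apply eq_over_castr].
  eapply eq_over_trans; [apply tmsub_comp |].
  apply tmsub_eq_over, eq_over_castr.
- eapply eq_over_trans; [apply eq_over_castl |].
  eapply eq_over_trans; [| apply eq_over_castr].
  eapply eq_over_trans; [apply tmsub_comp |].
  apply tmsub_eq_over, eq_over_castr.
Qed.

(** The eliminators are added to the given [S]; the equation [sintro T = S] lets the equivalence
    proved for [S] pass to [T]. *)
Lemma stable_id_of_intro {C : CwF} (W : WeakId C)
    (hC : has_familially_representable_poly_sorts C) (S : StableIdIntro C)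
    (hS : weakly_stable_elims W S) : exists T : StableId C, sintro T = S.
Proof.
destruct (natural_section _ (elim_generics hC S) (Elim S) (elim_sub S) (mk_elim S)
  (un_elim S) (un_mk_elim S) (mk_un_elim S) (mk_elim_sub S) (JData S) (j_data_sub S)
  (j_data_sub_comp S)) as [sec Hsec].
{ intros G [[A x] P d]; destruct (stable_J_exists hS x P d) as [j [b]].
  constructor; exact (existT _ j b). }
pose (J := fun (G : C) (A : Ty G) (x : Tm G A) (P : Ty (G ,, A ,, pId S A x))
  (d : Tm G P.[st_refl_inst S x]) => sec G (mkElim S (existT _ A x) P d)).
(* Naturality of the section; its two components are the substitution laws for J and for the
   computation term. *)
assert (HJ : forall G D (r : Hom D G) A x P d,
  J D _ _ _ (st_method_sub r d) = j_data_sub S G D r _ (J G A x P d)).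
{ intros; exact (Hsec G D r (mkElim S (existT _ A x) P d)). }
unshelve eexists (@Build_StableId C S (fun G A x P d => projT1 (J G A x P d)) _
  (fun G A x P d => projT2 (J G A x P d)) _); [| | reflexivity].
- intros G D r A x P d; symmetry; exact (f_equal (@projT1 _ _) (HJ G D r A x P d)).
- intros G D r A x P d; cbv beta; rewrite HJ; apply eq_over_castr.
Qed.

Theorem theorem1 (C : CwF) (W : WeakId C)
    (hC : has_familially_representable_poly_sorts C) :
  exists S : StableId C,
    forall (G : C) (A : Ty G) (x : Tm G A),
      equivalent_types W (sId S A.[pp A] x.{pp A} (qq A)) (wId W A x).
Proof.
destruct (stable_id_intro W hC) as [S hS].
destruct (stable_id_of_intro W hC S hS) as [T eT].
exists T; intros G A x; rewrite eT; exact (equivalent_to_weak W S hS x).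
Qed.
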